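(* Let $R$ be a commutative ring and let $(N,+,\circ)$ be a finite $R$-brace of order a power of a prime $p$. Let $A=R/\mathrm{Ann}_R(N)$ (a finite ring), let $A=\bigoplus_{i=1}^tA_i$ be its decomposition into a direct sum of finite local rings, where $A_i$ has residue field isomorphic to $\mathbb F_{p^{\lambda_i}}$ (all the residue characteristics are equal to $p$), and let $\lambda=\gcd\{\lambda_i\mid i=1,\dots,t\}$. Assume that $\mathrm{rank}_{\mathbb Z}(N,+)<\lambda(p-1)$. Then $(N,+)$ and $(N,\circ)$ have the same number of elements of each order, and if $(N,\circ)$ is abelian, then $(N,+)\cong(N,\circ)$ as groups.
   Context: A (left) brace is a set $N$ with two group operations $+$ and $\circ$, with $(N,+)$ abelian, such that $x\circ(y+z)=(x\circ y)-x+(x\circ z)$ for all $x,y,z\in N$. Its gamma function is $x\mapsto\gamma_x$, where $\gamma_x(y)=-x+x\circ y$; each $\gamma_x$ is an automorphism of $(N,+)$. Given a ring $R$, an $R$-brace is a brace $(N,+,\circ)$ such that $(N,+)$ is an $R$-module and every $\gamma_x$ ($x\in N$) is an automorphism of $R$-modules. Rings have identity and modules are unital. For a finite abelian group $M$, $\mathrm{rank}_{\mathbb Z}M$ is the number of summands in the decomposition of $(M,+)$ as a direct sum of nonzero indecomposable cyclic groups. *)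

(* Defs.v *)
From HB Require Import structures.
From mathcomp Require Import all_boot all_order all_algebra all_fingroup all_solvable.

Set Implicit Arguments.
Unset Strict Implicit.
Unset Printing Implicit Defensive.

Import GRing.Theory.
Local Open Scope ring_scope.

(* Ideals and quotients of commutative rings.  The library's [idealr] and its
   ring structure on [{ideal_quot I}] require 1 \notin I; here the unit ideal
   is allowed, so that R / Ann_R(N) also makes sense for N = 0. *)

Definition ideal_closed (R : comPzRingType) (I : {pred R}) : Prop :=
  [/\ 0 \in I, (forall x y, x \in I -> y \in I -> x - y \in I)
    & (forall a x, x \in I -> a * x \in I)].

Record ideal (R : comPzRingType) := Ideal {
  ideal_mem :> {pred R};
  ideal_memP : ideal_closed ideal_mem
}.

Fact ideal_zmod_closed (R : comPzRingType) (I : ideal R) : zmod_closed I.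
Proof. by case: (ideal_memP I). Qed.

HB.instance Definition _ (R : comPzRingType) (I : ideal R) :=
  GRing.isZmodClosed.Build R (ideal_mem I) (ideal_zmod_closed I).

Definition ideal_zmodClosed (R : comPzRingType) (I : ideal R) : zmodClosed R :=
  GRing.ZmodClosed.clone R (ideal_mem I) _.

Definition quotient_ring (R : comPzRingType) (I : ideal R) : Type :=
  Quotient.quot (ideal_zmodClosed I).

Section QuotientRing.
Variables (R : comPzRingType) (I : ideal R).
Local Open Scope quotient_scope.
Local Notation Q := (quotient_ring I).

HB.instance Definition _ := GRing.Zmodule.on Q.

Definition quotient_pi (x : R) : Q := \pi_(Quotient.quot (ideal_zmodClosed I)) x.

Definition quotient_repr (x : Q) : R :=
  generic_quotient.repr (x : Quotient.quot (ideal_zmodClosed I)).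

Fact quotient_reprK : cancel quotient_repr quotient_pi.
Proof. by move=> x; rewrite /quotient_pi /quotient_repr reprK. Qed.

Fact quotient_piP x y : (quotient_pi x == quotient_pi y) = (x - y \in I).
Proof. by rewrite /quotient_pi -Quotient.idealrBE. Qed.

Fact quotient_piD : {morph quotient_pi : x y / x + y}.
Proof. exact: Quotient.pi_add. Qed.

Definition quotient_one : Q := quotient_pi 1.
Definition quotient_mul (x y : Q) : Q :=
  quotient_pi (quotient_repr x * quotient_repr y).

Fact quotient_piM x y :
  quotient_pi (x * y) = quotient_mul (quotient_pi x) (quotient_pi y).
Proof.
have [_ _ IM] := ideal_memP I; have [_ IB] := ideal_zmod_closed I.
apply/eqP; rewrite quotient_piP.
set x' := quotient_repr _; set y' := quotient_repr _.
have xx' : x - x' \in I by rewrite -quotient_piP quotient_reprK.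
have yy' : y - y' \in I by rewrite -quotient_piP quotient_reprK.
have -> : x * y - x' * y' = y * (x - x') - (- x' * (y - y')).
  rewrite mulNr opprK !mulrBr (mulrC y x) (mulrC y x').
  by rewrite addrA subrK.
by apply: IB; apply: IM.
Qed.

Fact quotient_mulA : associative quotient_mul.
Proof.
move=> x y z; rewrite -[x]quotient_reprK -[y]quotient_reprK -[z]quotient_reprK.
by rewrite -!quotient_piM mulrA.
Qed.

Fact quotient_mulC : commutative quotient_mul.
Proof. by move=> x y; rewrite /quotient_mul mulrC. Qed.

Fact quotient_mul1 : left_id quotient_one quotient_mul.
Proof.
by move=> x; rewrite -[x]quotient_reprK -quotient_piM mul1r.
Qed.

Fact quotient_mulD : left_distributive quotient_mul +%R.
Proof.
move=> x y z; rewrite -[x]quotient_reprK -[y]quotient_reprK -[z]quotient_reprK.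
by rewrite -quotient_piD -!quotient_piM mulrDl quotient_piD.
Qed.

HB.instance Definition _ := GRing.Zmodule_isComPzRing.Build Q
  quotient_mulA quotient_mulC quotient_mul1 quotient_mulD.

Fact quotient_pi_zmod_morphism : zmod_morphism quotient_pi.
Proof.
move=> x y; rewrite quotient_piD; congr (_ + _); exact: Quotient.pi_opp.
Qed.

Fact quotient_pi_monoid_morphism : monoid_morphism quotient_pi.
Proof. by split=> // x y; rewrite quotient_piM. Qed.

HB.instance Definition _ :=
  GRing.isZmodMorphism.Build R Q quotient_pi quotient_pi_zmod_morphism.
HB.instance Definition _ :=
  GRing.isMonoidMorphism.Build R Q quotient_pi quotient_pi_monoid_morphism.

End QuotientRing.

Definition ring_isom (R S : pzRingType) : Prop :=
  exists f : {rmorphism R -> S}, bijective f.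

(* Ideals are boolean predicates, which loses nothing for finite rings. *)

Definition maximal_ideal (A : comPzRingType) (m : ideal A) : Prop :=
  1 \notin m /\
  forall J : ideal A, {subset m <= J} -> 1 \notin J -> J =i m.

Definition local_ring (A : finComNzRingType) : Prop :=
  exists2 m : ideal A, maximal_ideal m &
    forall m' : ideal A, maximal_ideal m' -> m' =i m.

(* For A local, m is unique. *)
Definition residue_field_isom (A : finComNzRingType) (F : fieldType) : Prop :=
  exists2 m : ideal A, maximal_ideal m & ring_isom (quotient_ring m) F.

Definition prod_ring (t : nat) (A_ : 'I_t -> finComNzRingType) : Type :=
  {dffun forall i : 'I_t, A_ i}.

Section ProductRing.
Variables (t : nat) (A_ : 'I_t -> finComNzRingType).
Local Notation P := (prod_ring A_).
Implicit Types f g h : P.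

HB.instance Definition _ := Choice.on P.

Definition prod_zero : P := [ffun i => 0].
Definition prod_opp f : P := [ffun i => - f i].
Definition prod_add f g : P := [ffun i => f i + g i].
Definition prod_one : P := [ffun i => 1].
Definition prod_mul f g : P := [ffun i => f i * g i].

Fact prod_addA : associative prod_add.
Proof. by move=> f g h; apply/ffunP=> i; rewrite !ffunE addrA. Qed.
Fact prod_addC : commutative prod_add.
Proof. by move=> f g; apply/ffunP=> i; rewrite !ffunE addrC. Qed.
Fact prod_add0 : left_id prod_zero prod_add.
Proof. by move=> f; apply/ffunP=> i; rewrite !ffunE add0r. Qed.
Fact prod_addN : left_inverse prod_zero prod_opp prod_add.
Proof. by move=> f; apply/ffunP=> i; rewrite !ffunE addNr. Qed.

HB.instance Definition _ :=
  GRing.isZmodule.Build P prod_addA prod_addC prod_add0 prod_addN.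

Fact prod_mulA : associative prod_mul.
Proof. by move=> f g h; apply/ffunP=> i; rewrite !ffunE mulrA. Qed.
Fact prod_mulC : commutative prod_mul.
Proof. by move=> f g; apply/ffunP=> i; rewrite !ffunE mulrC. Qed.
Fact prod_mul1 : left_id prod_one prod_mul.
Proof. by move=> f; apply/ffunP=> i; rewrite !ffunE mul1r. Qed.
Fact prod_mulD : left_distributive prod_mul +%R.
Proof. by move=> f g h; apply/ffunP=> i; rewrite !ffunE mulrDl. Qed.

HB.instance Definition _ :=
  GRing.Zmodule_isComPzRing.Build P prod_mulA prod_mulC prod_mul1 prod_mulD.

End ProductRing.

HB.mixin Record Zmodule_isBrace N of GRing.Zmodule N := {
  circ : N -> N -> N;
  circ_one : N;
  circ_inv : N -> N;
  circA : associative circ;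
  circ1x : left_id circ_one circ;
  circVx : left_inverse circ_one circ_inv circ;
  circDr : forall x y z : N, circ x (y + z) = circ x y - x + circ x z
}.

#[short(type="braceType")]
HB.structure Definition Brace := {N of GRing.Zmodule N & Zmodule_isBrace N}.

Definition brace_gamma (N : braceType) (x y : N) : N := - x + circ x y.

HB.mixin Record Brace_isRBrace (R : comNzRingType) N
    of Brace N & GRing.Lmodule R N := {
  gamma_linear : forall x : N, linear (brace_gamma x : N -> N);
  gamma_bij : forall x : N, bijective (brace_gamma x)
}.

#[short(type="rBraceType")]
HB.structure Definition RBrace (R : comNzRingType) :=
  {N of Brace N & GRing.Lmodule R N & Brace_isRBrace R N}.

#[short(type="finRBraceType")]
HB.structure Definition FinRBrace (R : comNzRingType) :=
  {N of RBrace R N & Finite N}.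

(* The finGroupType structure on N itself is (N, +), as for [finZmodType];
   [circ_group N] is a copy of N carrying the group (N, circ). *)
#[non_forgetful_inheritance]
HB.instance Definition _ (R : comNzRingType) (N : finRBraceType R) :=
  [finGroupMixin of N for +%R].

Definition circ_group (R : comNzRingType) (N : finRBraceType R) : Type := N.

HB.instance Definition _ (R : comNzRingType) (N : finRBraceType R) :=
  Finite.on (circ_group N).
HB.instance Definition _ (R : comNzRingType) (N : finRBraceType R) :=
  Finite_isGroup.Build (circ_group N) (@circA N) (@circ1x N) (@circVx N).

Section Annihilator.
Variables (R : comNzRingType) (N : finRBraceType R).

Definition ann_mem (r : R) : bool := [forall x : N, r *: x == 0].

Fact ann_memP : ideal_closed ann_mem.
Proof.
split=> [|r s /forallP r0 /forallP s0|a r /forallP r0]; apply/forallP=> x.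
- by rewrite scale0r.
- by rewrite scalerBl (eqP (r0 x)) (eqP (s0 x)) subr0.
- by rewrite -scalerA (eqP (r0 x)) scaler0.
Qed.

Definition ann : ideal R := Ideal ann_memP.

End Annihilator.

Definition indecomposable (gT : finGroupType) (G : {set gT}) : Prop :=
  forall H K : {group gT}, (H \x K)%g = G -> H :=: 1%g \/ K :=: 1%g.

(* Determined by gT up to Krull-Schmidt, hence a relation between gT and r. *)
Definition is_rankZ (gT : finGroupType) (r : nat) : Prop :=
  exists b : r.-tuple gT,
    (\big[dprod/1]_(x <- b) <[x]> = [set: gT])%g /\
    forall x, x \in b -> <[x]>%g != 1%g /\ indecomposable <[x]>%g.

Definition num_of_order (gT : finGroupType) (k : nat) : nat :=
  #|[set x : gT | #[x]%g == k]|.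

(* Main.v *)
Require Import Defs.
From HB Require Import structures.
From mathcomp Require Import all_boot all_order all_algebra all_fingroup all_solvable.

Set Implicit Arguments.
Unset Strict Implicit.
Unset Printing Implicit Defensive.

Import GRing.Theory.
Local Open Scope ring_scope.

(** Every element has the same order in (N, +) and in (N, o); both conclusions
    follow, since two finite abelian p-groups whose p^k-torsions have equal
    sizes are isomorphic ([isog_abelian_card_Ldiv]).

    The p-th power of x for o is the sum of the g^i(x), i < p, where g is the
    gamma map of x, and orders agree as soon as this sum vanishes on y exactly
    when p y does ([sum_iter_eq0], applied to the multiples y = p^k x).  Put
    u = g - 1, which is R-linear, and nilpotent because g has p-power order on
    a p-group.  In Z[u] the sum is u^(p-1) + p w with w = 1 + u v, a unit since
    u is nilpotent ([geometric_sum_prime]), so what matters is that u^(p-1) is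
    dominated by p.

    This is where the rank enters.  If V is an R-submodule with a proper
    submodule W, then V / W has at least p^lambda elements: it contains a copy
    of a nonzero quotient of some local factor A_i, and this quotient surjects
    onto the residue field of A_i ([submod_index_residue]).  For
    a u-stable submodule K, the chain K, u K + p K, u^2 K + p K, ... decreases
    strictly until it reaches p K, and |K / p K| is at most the size p^rank of
    the p-torsion of N; as rank < lambda (p - 1), fewer than p - 1 steps are
    possible, and u^(p-2) K is contained in p K ([nilpotent_descent]).

    With K the p-torsion this gives u^(p-1) K = 0, so p y = 0 makes the sum
    vanish.  With K the kernel of the sum, p K = p w K = u^(p-1) K lies in
    u p K, whence p K = 0 by nilpotence ([torsion_perturbation]). *)

(** * Sums of powers in a commutative ring *)

Lemma sum_expr1D (B : comNzRingType) (u : B) n :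
  \sum_(i < n) (u + 1) ^+ i = \sum_(i < n) u ^+ i *+ 'C(n, i.+1).
Proof.
elim: n => [|n IHn]; first by rewrite !big_ord0.
rewrite big_ord_recr IHn /= exprD1n.
under [RHS]eq_bigr do rewrite binS mulrnDr.
by rewrite big_split /= [in RHS]big_ord_recr /= bin_small // mulr0n addr0.
Qed.

(** The inner coefficients 'C(p, i) of the previous sum are multiples of p; the
    two extreme ones give u^(p-1) and p itself. *)
Lemma geometric_sum_prime (B : comNzRingType) (u : B) s : prime s.+2 ->
  exists v : B,
    \sum_(i < s.+2) (u + 1) ^+ i = u ^+ s.+1 + s.+2%:R * (1 + u * v).
Proof.
move=> p_pr; exists (\sum_(i < s) u ^+ i *+ ('C(s.+2, i.+2) %/ s.+2)).
rewrite sum_expr1D big_ord_recr big_ord_recl /= binn mulr1n bin1 expr0.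
rewrite addrC mulrDr mulr1; congr (_ + (_ + _)).
rewrite mulrCA !mulr_sumr; apply: eq_bigr => i _.
rewrite /bump /= add1n mulr_natl -mulrnA divnK ?mulrnAr -?exprS //.
by rewrite prime_dvd_bin //= !ltnS.
Qed.

(** Modulo p this is the Frobenius identity; it makes u nilpotent modulo p when
    (u + 1)^(p^k) acts as the identity. *)
Lemma exprD1_ppow (B : comNzRingType) (u : B) p k : prime p ->
  exists c : B, (u + 1) ^+ (p ^ k) = u ^+ (p ^ k) + 1 + p%:R * c.
Proof.
move=> p_pr.
have frob (a b : B) : exists c, (a + b) ^+ p = a ^+ p + b ^+ p + p%:R * c.
  case: p p_pr => // p p_pr.
  exists (\sum_(i < p)
    (a ^+ (p - i) * b ^+ i.+1) *+ ('C(p.+1, i.+1) %/ p.+1)).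
  rewrite exprDn big_ord_recr big_ord_recl /= subnn bin0 binn !mulr1n.
  rewrite mulr1 mul1r subn0 mulr_sumr addrAC; congr (_ + _).
  apply: eq_bigr => i _; rewrite /bump /= add1n subSS mulr_natl -mulrnA divnK //.
  by rewrite prime_dvd_bin //= ltnS.
elim: k => [|k [c IHk]]; first by exists 0; rewrite !expn0 !expr1 mulr0 addr0.
rewrite expnSr !exprM {}IHk.
have [c1 ->] := frob (u ^+ (p ^ k) + 1) (p%:R * c).
have [c2 ->] := frob (u ^+ (p ^ k)) 1.
exists (c2 + c * (p%:R * c) ^+ p.-1 + c1).
have -> : (p%:R * c) ^+ p = p%:R * (c * (p%:R * c) ^+ p.-1).
  by rewrite mulrA -exprS prednK ?prime_gt0.
by rewrite expr1n !mulrDr !addrA.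
Qed.

(** * A linear endomorphism as multiplication by the variable *)

(** M over {poly R} with 'X acting as f.  All endomorphisms used below become
    scalars of one commutative ring, so kernels and images of scalars are
    submodules and no commutation has to be tracked. *)
Definition poly_module (R : comNzRingType) (M : finLmodType R)
  (f : {linear M -> M}) : Type := M.

Section PolyModule.
Variables (R : comNzRingType) (M : finLmodType R) (f : {linear M -> M}).
Implicit Types (P Q : {poly R}) (x : M).

Definition poly_scale P x : M := \sum_(i < size P) P`_i *: iter i f x.

Lemma poly_scale_wide n P x :
  (size P <= n)%N -> poly_scale P x = \sum_(i < n) P`_i *: iter i f x.
Proof.
move=> leq_n; rewrite /poly_scale.
rewrite (big_ord_widen n (fun i => P`_i *: iter i f x)) //.
rewrite big_mkcond; apply: eq_bigr => i _; case: ltnP => // le_i.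
by rewrite nth_default // scale0r.
Qed.

Lemma poly_scaleDl x : {morph poly_scale^~ x : P Q / P + Q}.
Proof.
move=> P Q; pose n := maxn (size P) (size Q).
rewrite !(@poly_scale_wide n) ?leq_maxl ?leq_maxr ?size_polyD // -big_split.
by apply: eq_bigr => i _; rewrite coefD scalerDl.
Qed.

Lemma poly_scaleDr : right_distributive poly_scale +%R.
Proof.
move=> P x y; rewrite /poly_scale -big_split; apply: eq_bigr => i _ /=.
by rewrite -scalerDr; congr (_ *: _); elim: (val i) => //= j ->; rewrite linearD.
Qed.

Lemma poly_scaleC c x : poly_scale c%:P x = c *: x.
Proof.
by rewrite (@poly_scale_wide 1) ?size_polyC ?leq_b1 // big_ord1 coefC.
Qed.

Lemma poly_scaleMX P x : poly_scale (P * 'X) x = poly_scale P (f x).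
Proof.
rewrite (@poly_scale_wide (size P).+1); last first.
  by rewrite (leq_trans (size_polyMleq _ _)) // size_polyX addn2.
rewrite big_ord_recl coefMX eqxx scale0r add0r; apply: eq_bigr => i _.
by rewrite coefMX /= -iterSr.
Qed.

Lemma poly_scale_fX P x : poly_scale P (f x) = f (poly_scale P x).
Proof.
rewrite /poly_scale raddf_sum; apply: eq_bigr => i _.
by rewrite -iterSr /= linearZ.
Qed.

Lemma poly_scaleCM c P x : poly_scale (c%:P * P) x = c *: poly_scale P x.
Proof.
rewrite (@poly_scale_wide (size P)); last first.
  by rewrite mul_polyC size_scale_leq.
rewrite /poly_scale scaler_sumr; apply: eq_bigr => i _.
by rewrite coefCM scalerA.
Qed.

Lemma poly_scaleA P Q x : poly_scale P (poly_scale Q x) = poly_scale (P * Q) x.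
Proof.
elim/poly_ind: P x => [|P c IHP] x.
  by rewrite mul0r /poly_scale size_poly0 !big_ord0.
rewrite mulrDl !poly_scaleDl poly_scaleCM poly_scaleC poly_scaleMX; congr (_ + _).
by rewrite -poly_scale_fX IHP mulrAC poly_scaleMX.
Qed.

Lemma poly_scale1 : left_id 1 poly_scale.
Proof. by move=> x; rewrite poly_scaleC scale1r. Qed.

Local Notation Mf := (poly_module f).
HB.instance Definition _ := GRing.Zmodule.on Mf.
HB.instance Definition _ := Finite.on Mf.
HB.instance Definition _ := GRing.Zmodule_isLmodule.Build {poly R} Mf
  poly_scaleA poly_scale1 poly_scaleDr poly_scaleDl.

Lemma scale_polyX (x : Mf) : 'X *: x = f x.
Proof.
rewrite -[x in LHS]poly_scale1 scalerA mulrC.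
by apply: etrans (poly_scaleMX _ _) _; rewrite poly_scale1.
Qed.

Lemma scale_polyC c (x : Mf) : c%:P *: x = (c *: (x : M) : M).
Proof. exact: poly_scaleC. Qed.

End PolyModule.

(** * Nilpotent scalars on modules of small rank *)

Definition submod_index_ge (B : comNzRingType) (M : finLmodType B) (q : nat) :=
  forall V W : {set M}, GRing.submod_closed V -> GRing.submod_closed W ->
    W \proper V -> (q * #|W| <= #|V|)%N.

Section NilpotentScalar.
Variables (B : comNzRingType) (M : finLmodType B).
Implicit Types (V W K : {set M}) (u : B).

Lemma submod_add V W : GRing.submod_closed V -> GRing.submod_closed W ->
  GRing.submod_closed [set x + y | x in V, y in W].
Proof.
move=> [V0 VL] [W0 WL]; split; first by rewrite -(addr0 0) imset2_f.
move=> a _ _ /imset2P[x y Vx Wy ->] /imset2P[x' y' Vx' Wy' ->].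
by rewrite scalerDr addrACA imset2_f ?VL ?WL.
Qed.

Lemma submod_scale u V :
  GRing.submod_closed V -> GRing.submod_closed [set u *: x | x in V].
Proof.
move=> [V0 VL]; split; first by rewrite -(scaler0 _ u) imset_f.
move=> a _ _ /imsetP[x Vx ->] /imsetP[y Vy ->].
by rewrite scalerA mulrC -scalerA -scalerDr imset_f ?VL.
Qed.

Lemma submod_ker u : GRing.submod_closed [set x : M | u *: x == 0].
Proof.
split=> [|a x y]; rewrite !inE ?scaler0 // => /eqP x0 /eqP y0.
by rewrite scalerDr y0 addr0 scalerA mulrC -scalerA x0 scaler0.
Qed.

Lemma submodZ V a x : GRing.submod_closed V -> x \in V -> a *: x \in V.
Proof. by move=> [V0 VL] Vx; rewrite -[_ *: _]addr0 VL. Qed.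

Lemma submodD V x y : GRing.submod_closed V ->
  x \in V -> y \in V -> x + y \in V.
Proof. by move=> [V0 VL] Vx Vy; rewrite -[x]scale1r VL. Qed.

Lemma submodN V x : GRing.submod_closed V -> x \in V -> - x \in V.
Proof. by move=> sV Vx; rewrite -scaleN1r submodZ. Qed.

(** If K' = u K + W equals K then K is contained in u^j K + W for all j, hence
    in W.  Otherwise passing from K to K' divides the size by at least q, so the
    size bound leaves room for at most s such steps. *)
Lemma nilpotent_descent q u m W K s :
    submod_index_ge M q -> (forall x : M, u ^+ m *: x = 0) ->
    GRing.submod_closed W -> GRing.submod_closed K -> W \subset K ->
    (#|K| < q ^ s.+1 * #|W|)%N ->
  {in K, forall x, u ^+ s *: x \in W}.
Proof.
move=> idx um0 sW; elim: s K => [|s IHs] K sK sWK ltK x Kx.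
  rewrite scale1r; apply: contraLR ltK => notWx; rewrite -leqNgt expn1.
  by apply: idx => //; apply/properP; split=> //; exists x.
pose K' := [set x + y | x in [set u *: x | x in K], y in W].
have sK' : GRing.submod_closed K' by apply/submod_add/sW/submod_scale.
have sWK' : W \subset K'.
  apply/subsetP=> y Wy; rewrite -[y]add0r imset2_f //.
  by rewrite -(scaler0 _ u) imset_f //; case: sK.
have sK'K : K' \subset K.
  apply/subsetP=> _ /imset2P[_ y /imsetP[z Kz ->] Wy ->].
  by rewrite submodD ?submodZ // (subsetP sWK).
have uK' z : z \in K -> u *: z \in K'.
  by move=> Kz; rewrite -[_ *: _]addr0 imset2_f ?imset_f //; case: sW.
have [eqK | neqK] := eqVneq K' K.
  have subW j z : z \in K ->
      exists2 y, y \in W & exists2 z', z' \in K & z = u ^+ j *: z' + y.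
    elim: j z => [|j IHj] z Kz.
      by exists 0; [case: sW | exists z; rewrite ?scale1r ?addr0].
    have [y Wy [z' Kz' ->]] := IHj z Kz.
    rewrite -eqK in Kz'; case/imset2P: Kz' => _ w /imsetP[z'' Kz'' ->] Ww ->.
    exists (u ^+ j *: w + y); first by rewrite submodD ?submodZ.
    by exists z''; rewrite // scalerDr scalerA -exprSr addrA.
  have [y Wy [z _ ->]] := subW m x Kx.
  by rewrite um0 add0r submodZ.
have leK : (q * #|K'| <= #|K|)%N by apply: idx; rewrite // properEneq neqK.
rewrite exprSr -scalerA (IHs K') ?uK' //.
have q_gt0 : (0 < q)%N by case: (q) ltK; rewrite ?exp0n.
by rewrite -(ltn_pmul2l q_gt0) mulnA -expnS (leq_ltn_trans leK).
Qed.

(** Applied to u = p, it bounds |K / p K| by the p-torsion of the whole of M,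
    uniformly in K. *)
Lemma card_scale_ker u K : GRing.submod_closed K ->
  (#|K| <= #|[set u *: x | x in K]| * #|[set x : M | (u *: x == 0)%R]|)%N.
Proof.
move=> sK; rewrite -sum1_card (partition_big_imset (fun x => u *: x)) /=.
rewrite -sum_nat_const; apply: leq_sum => _ /imsetP[x Kx ->].
rewrite sum1_card -(card_imset _ (addIr (- x))); apply/subset_leq_card.
apply/subsetP=> _ /imsetP[y /andP[_ /eqP uy] ->]; rewrite inE.
by rewrite scalerBr uy subrr.
Qed.

(** The kernel K of the perturbed scalar satisfies c K <= u c K, so c K = 0 by
    nilpotence of u; this avoids inverting 1 + u v. *)
Lemma torsion_perturbation c s q u v m :
    submod_index_ge M q -> (forall x : M, u ^+ m *: x = 0) ->
    (#|[set x : M | (c *: x == 0)%R]| < q ^ s.+1)%N ->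
  forall y : M, ((u ^+ s.+1 + c * (1 + u * v)) *: y == 0) = (c *: y == 0).
Proof.
move=> idx um0 lt_tor y; apply/eqP/eqP=> [Sy0|cy0]; last first.
  (* The descent through the c-torsion, down to W = 0. *)
  have s0 : GRing.submod_closed [set 0 : M].
    by split=> [|a x z]; rewrite !inE // => /eqP-> /eqP->; rewrite scaler0 addr0.
  have /set1P us0 : u ^+ s *: y \in [set 0].
    apply: (nilpotent_descent idx um0 s0 (submod_ker c)).
    - by rewrite sub1set inE scaler0.
    - by rewrite cards1 muln1.
    - by rewrite inE cy0.
  rewrite scalerDl exprS -scalerA us0 mulrC -scalerA cy0.
  by rewrite !scaler0 addr0.
set S := u ^+ s.+1 + _ in Sy0 *.
pose K := [set x : M | S *: x == 0].
have sK : GRing.submod_closed K by apply: submod_ker.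
have sWK : [set c *: x | x in K] \subset K.
  by apply/subsetP=> _ /imsetP[x Kx ->]; rewrite submodZ.
have usK : {in K, forall x, u ^+ s *: x \in [set c *: x | x in K]}.
  apply: (nilpotent_descent idx um0) => //; first exact: submod_scale.
  rewrite mulnC (leq_ltn_trans (card_scale_ker c sK)) // ltn_pmul2l //.
  by apply/card_gt0P; exists (c *: 0); rewrite imset_f //; case: sK.
(* As S x = 0, c x = - u (u^s x) - u v c x, and u^s x lies in c K. *)
have cK_ucK x : x \in K -> exists2 z, z \in K & c *: x = u *: (c *: z).
  move=> Kx; have /imsetP[z Kz usx] := usK x Kx.
  exists (- (z + v *: x)); first by rewrite submodN ?submodD ?submodZ.
  move: Kx; rewrite inE /S scalerDl mulrDr mulr1 scalerDl exprS -scalerA usx.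
  rewrite addrCA addr_eq0 => /eqP->; rewrite scalerN scalerN; congr (- _).
  by rewrite !scalerDr !scalerA; congr (_ + _ *: _); rewrite mulrCA mulrA.
have cK_ujcK j x : x \in K -> exists2 z, z \in K & c *: x = u ^+ j *: (c *: z).
  elim: j x => [|j IHj] x Kx; first by exists x; rewrite ?scale1r.
  have [z Kz ->] := IHj x Kx; have [z' Kz' ->] := cK_ucK z Kz.
  by exists z'; rewrite // scalerA -exprSr.
have Ky : y \in K by rewrite inE Sy0.
by have [z _ ->] := cK_ujcK m y Ky; apply: um0.
Qed.

End NilpotentScalar.

(** * Norms of automorphisms of prime power order *)

Section PrimePowerAutomorphism.
Variables (R : comNzRingType) (M : finLmodType R) (f : {linear M -> M}).
Variables (p n k q : nat).
Hypothesis p_prime : prime p.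
Hypothesis exp_p : forall x : M, x *+ p ^ n = 0.
Hypothesis f_ppow : forall x : M, iter (p ^ k) f x = x.

Let g (x : M) := f x - x.
Fact sub_id_linear : linear g.
Proof. by move=> a x y; rewrite /g linearP scalerBr addrACA opprD. Qed.
HB.instance Definition _ := GRing.isLinear.Build R M M _ g sub_id_linear.
Let Mg := poly_module g.

Lemma iter_scale i (x : Mg) : ('X + 1) ^+ i *: x = iter i f x.
Proof.
elim: i => [|i IHi]; first by rewrite scale1r.
rewrite exprS -scalerA IHi scalerDl scale1r scale_polyX; exact: subrK.
Qed.

(** Since (u + 1)^(p^k) acts as 1, u^(p^k) acts as a multiple of p, and p^n kills
    M. *)
Lemma sub_id_nilpotent (x : Mg) : 'X ^+ (p ^ k * n) *: x = 0.
Proof.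
have [c Dc] := exprD1_ppow ('X : {poly R}) k p_prime.
have uE (y : Mg) : 'X ^+ (p ^ k) *: y = (- p%:R * c) *: y.
  have := iter_scale (p ^ k) y; rewrite f_ppow Dc !scalerDl scale1r.
  move/eqP; rewrite addrAC -subr_eq0 addrK addr_eq0 => /eqP->.
  by rewrite mulNr scaleNr.
have uiE i (y : Mg) : 'X ^+ (p ^ k * i) *: y = ((- p%:R * c) ^+ i) *: y.
  elim: i => [|i IHi]; first by rewrite muln0.
  by rewrite mulnS exprD -scalerA IHi uE scalerA exprS.
rewrite uiE mulNr exprNn exprMn -natrX mulrCA -scalerA scaler_nat.
exact: exp_p.
Qed.

(** The polynomial 'X acts on M as u = f - 1, so the sum becomes the scalar
    computed in [geometric_sum_prime]. *)
Lemma sum_iter_eq0 (y : M) :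
    submod_index_ge M q -> (#|[set x : M | (x *+ p == 0)%R]| < q ^ p.-1)%N ->
  (\sum_(i < p) iter i f y == 0) = (y *+ p == 0).
Proof.
move=> idx lt_tor; have sumE : \sum_(i < p) iter i f y =
    (\sum_(i < p) ('X + 1) ^+ i : {poly R}) *: (y : Mg).
  by rewrite scaler_suml; apply: eq_bigr => i _; rewrite iter_scale.
have idxg : submod_index_ge Mg q.
  have sub (V : {set Mg}) : GRing.submod_closed V ->
      GRing.submod_closed (V : {set M}).
    by case=> V0 VL; split=> // a z w; rewrite -(@scale_polyC R M g); apply: VL.
  by move=> V W /sub sV /sub sW; apply: idx.
rewrite sumE.
case: p p_prime lt_tor sub_id_nilpotent => [|[|s]] // p_pr lt_tor nilX.
have [v ->] := geometric_sum_prime ('X : {poly R}) p_pr.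
rewrite (torsion_perturbation _ idxg nilX) ?scaler_nat //.
suff -> : #|[set x : Mg | (s.+2%:R *: x == 0)%R]|
  = #|[set x : M | (x *+ s.+2 == 0)%R]| by [].
by apply: eq_card => x; rewrite !inE scaler_nat.
Qed.

End PrimePowerAutomorphism.

(** * Submodules have large index *)

(** Boolean, so that maximal ideals can be found among finitely many sets. *)
Definition ideal_set (A : finComNzRingType) (S : {set A}) : bool :=
  [&& 0 \in S, [forall x in S, forall y in S, x - y \in S]
    & [forall a, forall x in S, a * x \in S]].

Lemma ideal_setP (A : finComNzRingType) (S : {set A}) :
  reflect (ideal_closed (mem S)) (ideal_set S).
Proof.
apply: (iffP and3P) => [[S0 /forall_inP SB /forallP SM]|[S0 SB SM]].
  split=> // [x y Sx Sy | a x Sx]; first by have /forall_inP := SB x Sx; apply.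
  by have /forall_inP := SM a; apply.
split=> //; first by apply/forall_inP=> x Sx; apply/forall_inP=> y; apply: SB.
by apply/forallP=> a; apply/forall_inP=> x; apply: SM.
Qed.

Lemma proper_sub_maximal (A : finComNzRingType) (J : ideal A) : 1 \notin J ->
  exists2 m : ideal A, maximal_ideal m & {subset J <= m}.
Proof.
move=> J1; have [J0 JB JM] := ideal_memP J.
pose proper_ideal (S : {set A}) := ideal_set S && (1 \notin S).
have properJ : proper_ideal [set x in J].
  rewrite /proper_ideal inE J1 andbT; apply/ideal_setP.
  by split=> [|x y|a x]; rewrite !inE; [exact: J0 | exact: JB | exact: JM].
have [S /maxsetP[/andP[/ideal_setP idS S1] maxS] /subsetP sJS] :=
  maxset_exists properJ.
exists (Ideal idS) => [|x Jx]; last by apply: sJS; rewrite inE.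
split=> // J' sSJ' J'1; have [J'0 J'B J'M] := ideal_memP J'.
have J'S : [set x in J'] = S.
  apply: maxS; last by apply/subsetP=> x Sx; rewrite inE sSJ'.
  rewrite /proper_ideal inE J'1 andbT; apply/ideal_setP.
  by split=> [|x y|a x]; rewrite !inE; [exact: J'0 | exact: J'B | exact: J'M].
by move=> x; rewrite -[x \in J'](in_set (mem J')) J'S.
Qed.

(** A section s of the residue map.  A proper ideal J lies in some maximal ideal,
    which by locality is the kernel of the residue map; so s stays injective
    modulo any proper ideal. *)
Lemma residue_section (A : finComNzRingType) (F : fieldType) :
    local_ring A -> residue_field_isom A F ->
  exists s : F -> A, forall J : ideal A, 1 \notin J ->
    forall x y, s x - s y \in J -> x = y.
Proof.
move=> [m0 _ m0_uniq] [m mmax [f [g fK gK]]].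
exists (fun x => quotient_repr (g x)) => J J1 x y Jxy.
have [m' m'max sJm'] := proper_sub_maximal J1.
apply: (can_inj gK); apply/eqP.
rewrite -[g x]quotient_reprK -[g y]quotient_reprK quotient_piP.
by rewrite (m0_uniq m mmax) -(m0_uniq m' m'max) sJm'.
Qed.

Section ProductInjection.
Variables (t : nat) (A_ : 'I_t -> finComNzRingType).

Definition prod_inj i (a : A_ i) : prod_ring A_ :=
  [ffun j => dfwith (fun k => 0 : A_ k) a j].

Lemma prod_injB i (a b : A_ i) : prod_inj (a - b) = prod_inj a - prod_inj b.
Proof.
apply/ffunP=> j; rewrite !ffunE.
by case: dfwithP => [|j' ne]; rewrite ?dfwith_in // !dfwith_out // subr0.
Qed.

Lemma prod_injM i (a b : A_ i) : prod_inj (a * b) = prod_inj a * prod_inj b.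
Proof.
apply/ffunP=> j; rewrite !ffunE.
by case: dfwithP => [|j' ne]; rewrite ?dfwith_in // !dfwith_out // mulr0.
Qed.

Lemma prod_inj_sum1 : \sum_(i < t) prod_inj (1 : A_ i) = 1.
Proof.
apply/ffunP=> j; rewrite [RHS]ffunE.
rewrite (big_morph (fun f : prod_ring A_ => f j) (id1 := 0) (op1 := +%R));
  last 2 first.
- by move=> f g; rewrite ffunE.
- by rewrite ffunE.
rewrite (bigD1 j) //= big1 ?addr0 => [|i ne]; rewrite ffunE ?dfwith_in //.
by rewrite dfwith_out.
Qed.

End ProductInjection.

(** For x in V outside W, the elements of A_i that carry x into W form an ideal,
    proper for some i since the idempotents of the factors sum to 1.  The
    multiples of x by lifts of the residue field of this A_i are then pairwise
    distinct modulo W, which gives an injection of F * W into V. *)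
Lemma submod_index_residue (R : comNzRingType) (N : finRBraceType R) (q t : nat)
    (A_ : 'I_t -> finComNzRingType) :
    ring_isom (quotient_ring (ann N)) (prod_ring A_) ->
    (forall i, local_ring (A_ i)) ->
    (forall i, exists2 F : finFieldType,
       (q <= #|F|)%N & residue_field_isom (A_ i) F) ->
  submod_index_ge (N : finLmodType R) q.
Proof.
move=> [f [g fK gK]] locA resA V W [V0 VL] [W0 WL].
case/properP=> [/subsetP sWV [x Vx W'x]].
(* The action of the product ring on x alone, through lifts to R. *)
pose act z : N := quotient_repr (g z) *: x.
have actE (a b : R) :
    quotient_pi (ann N) a = quotient_pi (ann N) b -> a *: x = b *: x.
  move/eqP; rewrite quotient_piP => /forallP/(_ x).
  by rewrite scalerBl subr_eq0 => /eqP.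
have actB y z : act (y - z) = act y - act z.
  rewrite /act -scalerBl; apply: actE; rewrite rmorphB /= !quotient_reprK.
  by apply: (can_inj fK); rewrite rmorphB !gK.
have actM y z : act (y * z) = quotient_repr (g y) *: act z.
  rewrite /act scalerA; apply: actE; rewrite rmorphM /= !quotient_reprK.
  by apply: (can_inj fK); rewrite rmorphM !gK.
have act1 : act 1 = x.
  rewrite /act -[RHS]scale1r; apply: actE; rewrite rmorph1 /= quotient_reprK.
  by apply: (can_inj fK); rewrite rmorph1 gK.
have act0 : act 0 = 0 by rewrite -(subrr 1) actB subrr.
have WB y z : y \in W -> z \in W -> y - z \in W.
  by move=> Wy Wz; rewrite addrC -scaleN1r WL.
have Ji i : ideal_closed [pred a : A_ i | act (prod_inj a) \in W].
  split=> [|a b|a b]; rewrite !inE.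
  - by rewrite -(subrr 0) prod_injB subrr act0.
  - by rewrite prod_injB actB; apply: WB.
  - by rewrite prod_injM actM -[_ *: _]addr0 => Wb; rewrite WL.
have [i Ji1] : exists i, act (prod_inj (1 : A_ i)) \notin W.
  apply/existsP; apply: contraR W'x; rewrite negb_exists => /forallP W1.
  rewrite -act1 -prod_inj_sum1.
  elim/big_rec: _ => [|i z _ Wz]; first by rewrite act0.
  have -> : prod_inj (1 : A_ i) + z = prod_inj (1 : A_ i) - (0 - z).
    by rewrite sub0r opprK.
  by rewrite actB actB act0 !WB // -[_ \in _]negbK W1.
have [F leqF resF] := resA i; have [s sP] := residue_section (locA i) resF.
pose h (c : F * N) := act (prod_inj (s c.1)) + c.2.
pose D := [set c : F * N | c.2 \in W].
have Dcard : #|D| = (#|F| * #|W|)%N.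
  rewrite -cardsT -cardsX; apply: eq_card => c.
  by rewrite !inE.
have hinj : {in D &, injective h}.
  move=> [c w] [d w']; rewrite !inE /h /= => Ww Ww' e.
  have cd : c = d.
    apply: (sP (Ideal (Ji i)) Ji1); rewrite inE prod_injB actB.
    have -> : act (prod_inj (s c)) = act (prod_inj (s d)) + w' - w.
      by rewrite -e addrK.
    by rewrite addrAC [_ + w']addrC addrK WB.
  by move: e; rewrite cd => /addrI ->.
apply: leq_trans (_ : #|D| <= _)%N; first by rewrite Dcard leq_mul2r leqF orbT.
rewrite -(card_in_imset hinj) subset_leq_card //; apply/subsetP.
move=> _ /imsetP[[c w] Dcw ->]; rewrite inE /= in Dcw.
by apply: VL => //; apply: sWV.
Qed.

(** * Abelian p-groups and their torsion *)

Section AbelianPGroups.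
Local Open Scope group_scope.

Lemma card_Ldiv_prime_rank (gT : finGroupType) (p r : nat) : prime p ->
  p.-group [set: gT] -> abelian [set: gT] -> is_rankZ gT r ->
  (#|'Ldiv_p([set: gT])%g| <= p ^ r)%N.
Proof.
move=> p_pr pG cGG [b [defG _]]; rewrite -[p in 'Ldiv_p(_)%g]expn1.
rewrite -(OhmEabelian pG) ?(abelianS (Ohm_sub _ _)) //.
have pO : p.-group 'Ohm_1([set: gT])%g by apply: pgroupS (Ohm_sub _ _) pG.
rewrite (card_pgroup pO) leq_exp2l ?prime_gt1 //.
have := count_logn_dprod_cycle p 0 defG; rewrite Ohm0 indexg1 => <-.
by rewrite -[X in (_ <= X)%N](size_tuple b) count_size.
Qed.

(** The multiplicity of k + 1 is the drop of the counts between k and k + 1. *)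
Lemma eq_count_gt_perm (s1 s2 : seq nat) : all (leq 1) s1 -> all (leq 1) s2 ->
    (forall k, count (ltn k) s1 = count (ltn k) s2) ->
  perm_eq s1 s2.
Proof.
have countE k s : count_mem k.+1 s = (count (ltn k) s - count (ltn k.+1) s)%N.
  elim: s => //= x s ->.
  have le : (count (ltn k.+1) s <= count (ltn k) s)%N.
    by apply: sub_count => y; apply: ltnW.
  by rewrite /=; case: (ltngtP k.+1 x); rewrite ?add0n ?subSS // addnBA.
move=> s1_gt0 s2_gt0 eq_s; apply/allP=> -[|k] _ /=; last by rewrite !countE !eq_s.
have mem0 s : all (leq 1) s -> count_mem 0 s = 0.
  by move=> /allP s_gt0; apply/count_memPn/negP=> /s_gt0.
by rewrite !mem0.
Qed.

(** In a decomposition into cyclic p-groups, the number of factors of order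
    greater than p^k is read off from the index of the p^k-torsion in the
    p^(k+1)-torsion; these numbers determine the abelian type. *)
Lemma isog_abelian_card_Ldiv (gT rT : finGroupType) (p : nat)
    (G : {group gT}) (H : {group rT}) :
    p.-group G -> p.-group H -> abelian G -> abelian H ->
    (forall k, #|'Ldiv_(p ^ k)(G)| = #|'Ldiv_(p ^ k)(H)|)%g ->
  G \isog H.
Proof.
move=> pG pH cGG cHH eqGH.
have cardO k : #|'Ohm_k(G)|%g = #|'Ohm_k(H)|%g.
  rewrite (OhmEabelian pG) ?(abelianS (Ohm_sub _ _)) // eqGH.
  by rewrite (OhmEabelian pH) ?(abelianS (Ohm_sub _ _)).
rewrite eq_abelian_type_isog //.
have typeP (xT : finGroupType) (X : {group xT}) : p.-group X -> abelian X ->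
  exists2 e, abelian_type X = [seq p ^ i | i <- e]%N & all (leq 1) e /\
    forall k, count (ltn k) e = logn p #|'Ohm_k.+1(X) : 'Ohm_k(X)|%g.
- move=> pX cXX; have [b defX def_t] := abelian_structure cXX.
  have ppow x : x \in b -> #[x] = (p ^ logn p #[x])%N.
    move=> bx; rewrite -p_part part_pnat_id //; apply: pnat_dvd pX.
    by rewrite -(bigdprod_card defX) (big_rem x) //= dvdn_mulr.
  exists [seq logn p #[x] | x <- b]; last split.
  - by rewrite -def_t -map_comp; apply/eq_in_map=> x bx; apply: ppow.
  - have /allP gt1 := abelian_type_gt1 X.
    apply/allP=> _ /mapP[x bx ->]; rewrite lt0n; apply/eqP=> x0.
    have := gt1 #[x]; rewrite -def_t map_f // => /(_ isT).
    by rewrite (ppow x bx) x0.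
  move=> k; rewrite -(count_logn_dprod_cycle _ _ defX) count_map.
  exact: eq_count.
have [e1 D1 [e1_gt0 count1]] := typeP _ _ pG cGG.
have [e2 D2 [e2_gt0 count2]] := typeP _ _ pH cHH.
have permE : perm_eq e1 e2.
  apply: eq_count_gt_perm => // k; rewrite count1 count2.
  by rewrite -!divgS ?Ohm_leq //= !cardO.
apply/eqP/(sorted_eq (leT := geq)).
- by move=> y x z /= le_yx le_zy; apply: leq_trans le_zy le_yx.
- by move=> x y /= /andP[le_yx le_xy]; apply/anti_leq/andP.
- exact: abelian_type_sorted.
- exact: abelian_type_sorted.
by rewrite D1 D2 perm_map.
Qed.

End AbelianPGroups.

(** * Powers in a brace *)

Section Brace.
Variable N : braceType.
Implicit Types x y z : N.

Lemma circE x y : circ x y = x + brace_gamma x y.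
Proof. by rewrite /brace_gamma addNKr. Qed.

Lemma circx0 x : circ x 0 = x.
Proof.
have := circDr x 0 0; rewrite addr0 => e; apply/eqP.
by rewrite -subr_eq0 -(inj_eq (addrI (circ x 0))) addr0 addrC -e.
Qed.

Lemma circ_one0 : circ_one = 0 :> N.
Proof. by rewrite -(circx0 circ_one) circ1x. Qed.

Lemma gamma0 y : brace_gamma 0 y = y.
Proof. by rewrite /brace_gamma -circ_one0 circ1x circ_one0 oppr0 add0r. Qed.

Lemma gamma_circ x y z :
  brace_gamma (circ x y) z = brace_gamma x (brace_gamma y z).
Proof.
by rewrite {1}/brace_gamma -circA [circ y z]circE circDr -addrA addKr.
Qed.

End Brace.

HB.instance Definition _ (R : comNzRingType) (N : finRBraceType R) (x : N) :=
  GRing.isLinear.Build R N N *:%R (brace_gamma x) (gamma_linear x).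

Section FiniteBrace.
Variables (R : comNzRingType) (N : finRBraceType R).

Lemma circ_expgE (x : circ_group N) k :
  (x ^+ k)%g = \sum_(i < k) iter i (brace_gamma (x : N)) (x : N).
Proof.
elim: k => [|k IHk]; first by rewrite big_ord0; apply: circ_one0.
rewrite expgS IHk big_ord_recl /=.
have -> : (x * \sum_(i < k) iter i (brace_gamma (x : N)) (x : N))%g =
  circ (x : N) (\sum_(i < k) iter i (brace_gamma (x : N)) (x : N)) by [].
by rewrite circE raddf_sum.
Qed.

Lemma circ_group1 : (1%g : circ_group N) = (0 : N).
Proof. exact: circ_one0. Qed.

Lemma iter_gamma (x : circ_group N) k (y : N) :
  iter k (brace_gamma (x : N)) y = brace_gamma ((x ^+ k)%g : N) y.
Proof.
elim: k => [|k IHk]; first by rewrite expg0 circ_group1 gamma0.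
by rewrite iterS IHk expgS -[(x * _)%g]/(circ (x : N) _) gamma_circ.
Qed.

Variables (p n q : nat).
Hypothesis p_prime : prime p.
Hypothesis cardN : #|N| = (p ^ n)%N.
Hypothesis idx : submod_index_ge (N : finLmodType R) q.
Hypothesis tor : (#|[set x : N | (x *+ p == 0)%R]| < q ^ p.-1)%N.

(** Induction on k: the p-th o-power of x is a sum over iterates of gamma, which
    commutes with multiplication by p^k, so [sum_iter_eq0] applies at p^k x. *)
Lemma circ_ppow_eq1 k (x : circ_group N) :
  ((x ^+ (p ^ k))%g == 1%g) = ((x : N) *+ p ^ k == 0).
Proof.
have exp_pn (y : N) : y *+ p ^ n = 0.
  by rewrite -cardN -cardsT; apply: (@expg_cardG N [set: N]%G); rewrite inE.
have iter_pn (z : circ_group N) (y : N) :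
    iter (p ^ n) (brace_gamma (z : N)) y = y.
  rewrite iter_gamma -cardN -cardsT.
  rewrite (@expg_cardG (circ_group N) [set: circ_group N]%G) ?inE //.
  by rewrite circ_group1 gamma0.
elim: k x => [|k IHk] x; first by rewrite expg1 mulr1n circ_group1.
rewrite expnS expgM IHk circ_expgE -sumrMnl mulnC mulrnA.
rewrite -(sum_iter_eq0 p_prime exp_pn (iter_pn x) _ idx tor).
congr (_ == 0); apply: eq_bigr => i _.
by elim: (val i) => //= j <-; rewrite raddfMn.
Qed.

Lemma order_circ (x : circ_group N) : #[x]%g = #[x : N]%g.
Proof.
have dvdE k : (#[x]%g %| p ^ k = (#[x : N]%g %| p ^ k))%N.
  by rewrite !order_dvdn circ_ppow_eq1.
have p_x : (#[x]%g %| p ^ n)%N.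
  by rewrite -cardN -(cardsT (circ_group N)) order_dvdG ?inE.
have p_Nx : (#[x : N]%g %| p ^ n)%N by rewrite -dvdE.
case/(dvdn_pfactor _ _ p_prime): p_x dvdE => a _ ->.
case/(dvdn_pfactor _ _ p_prime): p_Nx => b _ -> dvdE.
by apply/eqP; rewrite eqn_dvd dvdE dvdnn -dvdE dvdnn.
Qed.

End FiniteBrace.

(** * The comparison theorem *)

Theorem corollary4p11
  (R : comNzRingType) (N : finRBraceType R)
  (p n : nat) (p_prime : prime p) (cardN : #|N| = (p ^ n)%N)
  (t : nat) (A_ : 'I_t -> finComNzRingType) (lam : 'I_t -> nat)
  (A_local : forall i, local_ring (A_ i))
  (A_decomp : ring_isom (quotient_ring (ann N)) (prod_ring A_))
  (A_residue : forall i, exists2 F : finFieldType,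
     #|F| = (p ^ lam i)%N & residue_field_isom (A_ i) F)
  (r : nat) (rankN : is_rankZ N r)
  (rank_lt : (r < (\big[gcdn/0]_(i < t) lam i) * (p - 1))%N) :
  (forall k : nat, num_of_order N k = num_of_order (circ_group N) k) /\
  (abelian [set: circ_group N] -> [set: N] \isog [set: circ_group N]).
Proof.
set lambda := (\big[gcdn/0]_(i < t) lam i)%N in rank_lt.
have p_gt1 := prime_gt1 p_prime.
have pN : (p.-group [set: N])%g by rewrite /pgroup cardsT cardN pnatX pnat_id.
have pC : (p.-group [set: circ_group N])%g.
  by rewrite /pgroup cardsT cardN pnatX pnat_id.
have cNN : abelian [set: N].
  by apply/centsP=> x _ y _; apply: addrC.
have idx : submod_index_ge (N : finLmodType R) (p ^ lambda).
  apply: (submod_index_residue A_decomp A_local) => i.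
  have [F cardF resF] := A_residue i; exists F; rewrite // cardF.
  rewrite leq_exp2l // dvdn_leq ?(biggcdn_inf i) // lt0n.
  apply: contraTneq (card_finNzRing_gt1 F) => lam0.
  by rewrite cardF lam0.
have tor : (#|[set x : N | (x *+ p == 0)%R]| < (p ^ lambda) ^ p.-1)%N.
  rewrite -expnM -subn1 (leq_ltn_trans _ (_ : p ^ r < _)%N) ?ltn_exp2l //.
  apply: leq_trans (card_Ldiv_prime_rank p_prime pN cNN rankN).
  by apply/subset_leq_card/subsetP=> x; rewrite !inE.
have ordE := order_circ p_prime cardN idx tor.
split=> [k | cCC].
  by apply: eq_card => x; rewrite !inE ordE.
apply: (isog_abelian_card_Ldiv pN pC cNN cCC) => k.
by apply: eq_card => x; rewrite !inE -!order_dvdn ordE.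
Qed.
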